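(* For all integers $n\ge k\ge d=2m+1\ge 5$, the graph of the ordinary polytope $P^{d,k,n}$ has a Hamiltonian cycle.
   Context: An $e$-dimensional multiplex is an $e$-dimensional convex polytope with an ordered list of vertices $z_0,z_1,\ldots,z_N$ whose facets are exactly $\mathrm{conv}\{z_{i-e+1},\ldots,z_{i-1},z_{i+1},\ldots,z_{i+e-1}\}$ for $0\le i\le N$, with the conventions $z_j=z_0$ if $j<0$ and $z_j=z_N$ if $j>N$. Given an ordered set $V=\{x_0,\ldots,x_n\}$, a subset $Y\subseteq V$ is a Gale subset if between any two elements of $V\setminus Y$ there is an even number of elements of $Y$. A polytope with ordered vertex set $V$ is a Gale polytope if the vertex set of each facet is a Gale subset. An ordinary polytope is a Gale polytope such that each facet is a multiplex with the induced order on its vertices. If $P$ is an ordinary $d$-polytope with $d\ge5$ odd and ordered vertices $x_0,\ldots,x_n$, there is (known result) an integer $k$ with $d\le k\le n$, called the characteristic of $P$, such that the vertices sharing an edge with $x_0$ are exactly $x_1,\ldots,x_k$ and the vertices sharing an edge with $x_n$ are exactly $x_{n-1},\ldots,x_{n-k}$. It is known that for all $n\ge k\ge d\ge 5$ with $d$ odd, an ordinary $d$-polytope with $n+1$ vertices and characteristic $k$ exists, and all such are combinatorially isomorphic; it is denoted $P^{d,k,n}$. The graph of a polytope has as its vertices and edges the vertices and ($1$-dimensional) edges of the polytope. *)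

(* Defs.v *)
From HB Require Import structures.
From mathcomp Require Import all_boot all_order all_algebra.
From mathcomp Require Import all_classical all_reals.
From mathcomp Require Import convex.

Set Implicit Arguments.
Unset Strict Implicit.
Unset Printing Implicit Defensive.

Import Order.TTheory GRing.Theory Num.Theory.

Local Open Scope classical_set_scope.
Local Open Scope ring_scope.

Section Polytopes.
Context {R : realType} {D : nat}.
Implicit Types (A P F : set 'rV[R]_D) (p q : 'rV[R]_D).

Definition convex_hull A : set 'rV[R]_D :=
  smallest (fun C : set 'rV[R]_D => convex_set C) A.

Definition affinely_independent (m : nat) (y : 'I_m -> 'rV[R]_D) : Prop :=
  forall t : 'I_m -> R,
    \sum_i t i = 0 -> \sum_i t i *: y i = 0 -> forall i, t i = 0.

(* The affine hull of A has dimension e; the empty set has no dimension here. *)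
Definition has_dim A (e : nat) : Prop :=
  (exists y : 'I_e.+1 -> 'rV[R]_D,
      (forall i, A (y i)) /\ affinely_independent y) /\
  ~ (exists y : 'I_e.+2 -> 'rV[R]_D,
      (forall i, A (y i)) /\ affinely_independent y).

(* Faces are cut out by valid inequalities; c = 0 gives the improper faces. *)
Definition face P F : Prop :=
  exists (c : 'cV[R]_D) (b : R),
    (forall p, P p -> (p *m c) 0 0 <= b) /\
    F = [set p | P p /\ (p *m c) 0 0 = b].

Definition vertex P p : Prop := face P [set p].

Definition edge P F : Prop := face P F /\ has_dim F 1.

Definition facet P F : Prop :=
  exists e : nat, [/\ has_dim P e.+1, face P F & has_dim F e].

Definition adjacent P p q : Prop :=
  [/\ vertex P p, vertex P q, p <> q & exists F, [/\ edge P F, F p & F q]].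

Definition ordered_polytope P (n : nat) (x : 'I_n.+1 -> 'rV[R]_D) : Prop :=
  [/\ injective x, P = convex_hull (range x) & [set p | vertex P p] = range x].

(* Index of z_j, where z_j = z_0 for j < 0 and z_j = z_N for j > N. *)
Definition clamp (N : nat) (j : int) : 'I_N.+1 :=
  match j with
  | Posz m => inord (minn m N)
  | Negz _ => ord0
  end.

(* The index j is an integer clamped only afterwards, so that, e.g., z_0 is
   among the generators for i = 0 (through the indices j < 0). *)
Definition multiplex_facet (e N : nat) (z : 'I_N.+1 -> 'rV[R]_D)
    (i : 'I_N.+1) : set 'rV[R]_D :=
  convex_hull [set z (clamp N j) | j in
    [set j : int | [&& i%:Z - e%:Z + 1 <= j, j <= i%:Z + e%:Z - 1
                     & j != i%:Z]]].

Definition multiplex (e : nat) P (N : nat) (z : 'I_N.+1 -> 'rV[R]_D) : Prop :=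
  [/\ has_dim P e, ordered_polytope P z &
      forall F, facet P F <-> exists i : 'I_N.+1, F = multiplex_facet e z i].

End Polytopes.

Definition gale_subset (n : nat) (Y : {set 'I_n.+1}) : Prop :=
  forall i j : 'I_n.+1, i \notin Y -> j \notin Y -> (i < j)%N ->
    ~~ odd #|[pred l in Y | (i < l < j)%N]|.

Section Ordinary.
Context {R : realType} {D : nat}.
Implicit Types (P F : set 'rV[R]_D).

Definition gale_polytope P (n : nat) (x : 'I_n.+1 -> 'rV[R]_D) : Prop :=
  ordered_polytope P x /\
  forall F, facet P F ->
    forall Y : {set 'I_n.+1},
      (forall i, i \in Y <-> vertex F (x i)) -> gale_subset Y.

(* f enumerates increasingly the indices of the vertices of the facet F: that
   they are exactly the x (f l) is part of [multiplex]. *)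
Definition ordinary_polytope (d : nat) P (n : nat)
    (x : 'I_n.+1 -> 'rV[R]_D) : Prop :=
  [/\ has_dim P d, gale_polytope P x &
      forall F, facet P F ->
        exists (N : nat) (f : 'I_N.+1 -> 'I_n.+1),
          {homo f : a b / (a < b)%N} /\ multiplex d.-1 F (x \o f)].

Definition has_characteristic P (n : nat) (x : 'I_n.+1 -> 'rV[R]_D)
    (k : nat) : Prop :=
  (forall j : 'I_n.+1, adjacent P (x ord0) (x j) <-> (1 <= j <= k)%N) /\
  (forall j : 'I_n.+1,
      adjacent P (x ord_max) (x j) <-> (n - k <= j <= n.-1)%N).

End Ordinary.

Definition hamiltonian_cycle (T : eqType) (V : set T) (adj : T -> T -> Prop)
    (s : seq T) : Prop :=
  [/\ (2 < size s)%N, uniq s, forall v, v \in s <-> V v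
    & cycle [rel u v | `[< adj u v >]] s].

(* Main.v *)
(** The cycle is x_0, x_2, x_4, ..., x_5, x_3, x_1.  The characteristic gives the
    edges at x_0 and the edge between x_(n-1) and x_n, so it remains to see that
    x_i and x_(i+2) are adjacent for 0 < i <= n - 2.

    In a multiplex of dimension at least 4, two vertices at distance at most 2
    in the order are the only common vertices of the facets containing both,
    hence are adjacent; so it is enough to find a facet of P containing x_i,
    x_(i+1) and x_(i+2).  As every face of P is an intersection of facets, a
    vertex x_t of a facet F can be exchanged: some facet omits x_t and contains
    the vertices of F lying close to x_t.  If a facet contains x_i and x_(i+1)
    and never x_(i+2), then Gale evenness and repeated exchanges move its
    nearest further pair of vertices towards x_i, x_(i+1) until a contradiction
    is reached, unless all its other vertices are x_0 and x_n; but a facet has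
    at least five vertices. *)
Require Import Defs.
From mathcomp Require Import all_boot all_order all_algebra.
From mathcomp Require Import all_classical all_reals.
From mathcomp Require Import interval_inference convex.
From mathcomp Require Import zify ring.
Import Order.TTheory GRing.Theory Num.Theory.
Local Open Scope classical_set_scope.
Local Open Scope ring_scope.

Set Implicit Arguments.
Unset Strict Implicit.
Unset Printing Implicit Defensive.

(** * Affine functionals, convex hulls and faces *)

Section Geometry.
Context {R : realType} {D : nat}.
Implicit Types (A P F : set 'rV[R]_D) (p q : 'rV[R]_D) (h : 'cV[R]_(1 + D)).

(* Homogeneous coordinates: affine functionals become linear ones, and affine
   independence becomes linear independence. *)
Definition lift1 p : 'rV[R]_(1 + D) := row_mx 1%:M p.

Definition affval h p : R := (lift1 p *m h) 0 0.

Lemma sum_lift1 (I : finType) (w : I -> R) (y : I -> 'rV[R]_D) :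
  \sum_i w i *: lift1 (y i) = row_mx (\sum_i w i)%:M (\sum_i w i *: y i).
Proof.
rewrite /lift1; apply: (big_ind3 (fun a b c => a = row_mx b%:M c)).
- by rewrite raddf0 row_mx0.
- by move=> ? ? ? ? ? ? -> ->; rewrite add_row_mx raddfD.
- by move=> i _; rewrite scale_row_mx scale_scalar_mx mulr1.
Qed.

Lemma affvalD h1 h2 p : affval (h1 + h2) p = affval h1 p + affval h2 p.
Proof. by rewrite /affval mulmxDr mxE. Qed.

Lemma affvalZ (a : R) h p : affval (a *: h) p = a * affval h p.
Proof. by rewrite /affval -scalemxAr mxE. Qed.

Lemma affvalN h p : affval (- h) p = - affval h p.
Proof. by rewrite /affval mulmxN mxE. Qed.

Lemma affval0 p : affval 0 p = 0.
Proof. by rewrite /affval mulmx0 mxE. Qed.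

(** Sign convention: a valid inequality of [face] becomes nonnegativity of a functional, and the
    face becomes its zero set. *)
Lemma affval_ineq (c : 'cV[R]_D) (b : R) p :
  affval (col_mx b%:M (- c)) p = b - (p *m c) 0 0.
Proof. by rewrite /affval /lift1 mul_row_col mul1mx mulmxN !mxE eqxx. Qed.

Lemma affvalE h p : affval h p = (usubmx h) 0 0 - (p *m - dsubmx h) 0 0.
Proof.
by rewrite -{1}[h]vsubmxK /affval /lift1 mul_row_col mul1mx mulmxN !mxE opprK.
Qed.

Lemma affval_combo h (I : finType) (w : I -> R) (y : I -> 'rV[R]_D) :
  \sum_i w i = 1 ->
  affval h (\sum_i w i *: y i) = \sum_i w i * affval h (y i).
Proof.
move=> w1; have := sum_lift1 w y; rewrite w1 -/(lift1 _) /affval => <-.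
rewrite mulmx_suml summxE; apply: eq_bigr => i _.
by rewrite -scalemxAl mxE.
Qed.

Lemma affval_conv h (a : R) p q :
  affval h (a *: p + (1 - a) *: q) = a * affval h p + (1 - a) * affval h q.
Proof.
have -> : a *: p + (1 - a) *: q =
  \sum_(b : bool) (if b then a else 1 - a) *: (if b then p else q).
  by rewrite big_bool.
by rewrite affval_combo !big_bool //= addrC subrK.
Qed.

Lemma hull_ind (C : set 'rV[R]_D) A p :
  (forall u v (a : R), C u -> C v -> 0 <= a <= 1 -> C (a *: u + (1 - a) *: v)) ->
  A `<=` C -> convex_hull A p -> C p.
Proof.
move=> cC AC; apply: (smallest_sub (X := C)) => // u v t; rewrite !inE => Cu Cv.
apply: cC => //; apply/andP; split; [exact: ge0|exact: le1].
Qed.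

Lemma hull_combo (I : finType) (y : I -> 'rV[R]_D) p :
  convex_hull (range y) p ->
  exists w : I -> R, [/\ forall i, 0 <= w i, \sum_i w i = 1 &
                         p = \sum_i w i *: y i].
Proof.
apply: (hull_ind (C := [set p | exists w : I -> R,
   [/\ forall i, 0 <= w i, \sum_i w i = 1 & p = \sum_i w i *: y i]])).
- move=> u v a /= [w [w0 w1 ->]] [w' [w0' w1' ->]] /andP[a0 a1].
  exists (fun i => a * w i + (1 - a) * w' i); split.
  + by move=> i; rewrite addr_ge0 // mulr_ge0 // subr_ge0.
  + by rewrite big_split /= -!mulr_sumr w1 w1'; ring.
  + rewrite !scaler_sumr -big_split /=; apply: eq_bigr => i _.
    by rewrite !scalerA -scalerDl.
- move=> _ [i _ <-] /=; exists (fun j => (j == i)%:R); split.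
  + by move=> j; rewrite ler0n.
  + by rewrite (bigD1 i) //= eqxx big1 ?addr0 // => j /negPf ->.
  + rewrite (bigD1 i) //= eqxx scale1r big1 ?addr0 // => j /negPf ->.
    by rewrite scale0r.
Qed.

Lemma hull_affval_gt0 h A p :
  (forall a, A a -> 0 < affval h a) -> convex_hull A p -> 0 < affval h p.
Proof.
move=> hA; apply: (hull_ind (C := [set q | 0 < affval h q])) => // u v a /=.
rewrite affval_conv => u0 v0 /andP[].
(* For [a] equal to 0 the strict sign comes from [v]; otherwise it comes from [u], the other term
   being nonnegative. *)
rewrite le_eqVlt => /orP[/eqP <- _|a0 a1]; first by rewrite subr0 mul0r add0r mul1r.
by rewrite ltr_wpDr ?mulr_gt0 // mulr_ge0 ?subr_ge0 // ltW.
Qed.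

Lemma subset_hull A p : A p -> convex_hull A p.
Proof. exact: sub_gen_smallest. Qed.

(** * Dimension as matrix rank *)

Definition liftmx (m : nat) (y : 'I_m -> 'rV[R]_D) : 'M[R]_(m, 1 + D) :=
  \matrix_i lift1 (y i).

Lemma affinely_independentP (m : nat) (y : 'I_m -> 'rV[R]_D) :
  affinely_independent y <-> row_free (liftmx y).
Proof.
have mulE (v : 'rV[R]_m) : v *m liftmx y =
    row_mx (\sum_i v 0 i)%:M (\sum_i v 0 i *: y i).
  rewrite -sum_lift1 mulmx_sum_row; apply: eq_bigr => i _.
  by rewrite rowK.
split=> [aff|free t t0 ty i].
  apply: inj_row_free => v; rewrite mulE -row_mx0 => /eq_row_mx [/eqP v0 vy].
  have {}v0 : \sum_i v 0 i = 0.
    by move: v0 => /eqP /matrixP /(_ 0 0); rewrite !mxE eqxx.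
  by apply/rowP => i; rewrite mxE (aff (fun i => v 0 i)).
have : (\row_i t i) *m liftmx y = 0 *m liftmx y.
  rewrite mul0mx mulE.
  under eq_bigr do rewrite mxE.
  under [X in row_mx _ X]eq_bigr do rewrite mxE.
  by rewrite t0 ty raddf0 row_mx0.
by move/(row_free_inj free)/rowP/(_ i); rewrite !mxE.
Qed.

(** The lifts of [A] span the row space of [M], which bounds the size of independent families in
    [A]; a maximal free family of rows of [M] attains the bound. *)
Lemma has_dim_rank A (e m : nat) (M : 'M[R]_(m, 1 + D)) :
  (forall p, A p -> (lift1 p <= M)%MS) ->
  (forall i, exists2 p, A p & row i M = lift1 p) ->
  has_dim A e <-> \rank M = e.+1.
Proof.
move=> AM MA.
have rk r : (exists y : 'I_r -> 'rV[R]_D,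
    (forall i, A (y i)) /\ affinely_independent y) <-> (r <= \rank M)%N.
  split=> [[y [Ay /affinely_independentP]]|rM].
    rewrite -row_leq_rank => /leq_trans; apply; apply: mxrankS.
    by apply/row_subP => i; rewrite rowK; apply: AM.
  have [y Ay] := choice (fun i => let: ex_intro2 p h1 h2 := MA i in
    ex_intro (fun p => A p /\ row i M = lift1 p) p (conj h1 h2)).
  pose g i := maxrankfun M (widen_ord rM i).
  exists (fun i => y (g i)); split; first by move=> i; have [] := Ay (g i).
  apply/affinely_independentP.
  have -> : liftmx (fun i => y (g i)) =
     rowsub (widen_ord rM) (rowsub (maxrankfun M) M).
    by apply/row_matrixP => i; rewrite rowK !row_rowsub; have [] := Ay (g i).
  apply: inj_row_free => v; rewrite rowsubE mulmxA => H.
  have {}H : v *m rowsub (widen_ord rM) 1%:M = 0.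
    by apply: (row_free_inj (maxrowsub_free M)); rewrite /= mul0mx.
  apply/rowP => i; move/rowP: H => /(_ (widen_ord rM i)).
  rewrite !mxE (bigD1 i) //= !mxE eqxx mulr1 big1 ?addr0 // => j ji.
  by rewrite !mxE -val_eqE /= val_eqE (negPf ji) mulr0.
rewrite /has_dim !rk; split=> [[h1 h2]|->]; last by split=> //; rewrite ltnn.
by apply/eqP; rewrite eqn_leq h1 andbT leqNgt; apply/negP.
Qed.

(* S indexes the points of the family y lying on a supporting hyperplane; no
   requirement is made that S be nonempty or proper. *)
Definition exposed (I : finType) (y : I -> 'rV[R]_D) (S : {set I}) : Prop :=
  exists h, forall i, 0 <= affval h (y i) /\ (i \in S) = (affval h (y i) == 0).

Lemma exposedT (I : finType) (y : I -> 'rV[R]_D) : exposed y [set: I].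
Proof. by exists 0 => i; rewrite affval0 inE eqxx. Qed.

Lemma exposedI (I : finType) (y : I -> 'rV[R]_D) (S T : {set I}) :
  exposed y S -> exposed y T -> exposed y (S :&: T).
Proof.
move=> [h hS] [g gT]; exists (h + g) => i; have [h0 iS] := hS i.
by have [g0 iT] := gT i; rewrite affvalD addr_ge0 // inE iS iT paddr_eq0.
Qed.

(** Adding functionals intersects exposed sets, and [S] is the intersection of the separating ones;
    if there is nothing to separate, the zero functional serves. *)
Lemma exposed_sep (I : finType) (y : I -> 'rV[R]_D) (S : {set I}) :
  (forall c, c \notin S -> exists E, [/\ exposed y E, S \subset E & c \notin E]) ->
  exposed y S.
Proof.
move=> sep.
have sep' c : exists E : {set I}, c \notin S ->
    [/\ exposed y E, S \subset E & c \notin E].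
  by have [/sep [E ?]|] := boolP (c \notin S); [exists E|exists finset.set0].
have [E EP] := choice sep'.
have -> : S = (\bigcap_(c | c \notin S) E c)%SET.
  apply/eqP; rewrite finset.eqEsubset; apply/andP; split.
    by apply/finset.bigcapsP => c /EP[].
  apply/fintype.subsetP => c /finset.bigcapP cE; apply: contraT => cS.
  by have [_ _ /negP] := EP c cS; case; apply: cE.
apply: (big_ind (exposed y)); [exact: exposedT|exact: exposedI|].
by move=> c /EP[].
Qed.

Lemma face_halfspace P F : face P F ->
  exists h, (forall p, P p -> 0 <= affval h p) /\
            F = [set p | P p /\ affval h p = 0].
Proof.
move=> [c [b [Pb ->]]]; exists (col_mx b%:M (- c)); split.
  by move=> p /Pb; rewrite affval_ineq subr_ge0.
apply/seteqP; split=> p /= [Pp]; rewrite affval_ineq.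
  by move=> ->; rewrite subrr.
by move/eqP; rewrite subr_eq0 => /eqP.
Qed.

Lemma halfspace_face P h : (forall p, P p -> 0 <= affval h p) ->
  face P [set p | P p /\ affval h p = 0].
Proof.
move=> Ph; exists (- dsubmx h), ((usubmx h) 0 0); split.
  by move=> p /Ph; rewrite affvalE subr_ge0.
apply/seteqP; split=> p /= [Pp]; rewrite affvalE.
  by move/eqP; rewrite subr_eq0 => /eqP.
by move=> ->; rewrite subrr.
Qed.

Lemma hull_affval_ge0 (I : finType) (y : I -> 'rV[R]_D) h p :
  (forall i, 0 <= affval h (y i)) -> convex_hull (range y) p -> 0 <= affval h p.
Proof.
move=> h0 /hull_combo[w [w0 w1 ->]]; rewrite affval_combo //.
by apply: sumr_ge0 => i _; rewrite mulr_ge0.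
Qed.

Lemma face_exposed (I : finType) (y : I -> 'rV[R]_D) P F :
  P = convex_hull (range y) -> face P F ->
  exposed y [set i | `[< F (y i) >]]%SET.
Proof.
move=> PE /face_halfspace[h [Ph ->]]; exists h => i.
have Py : P (y i) by rewrite PE; apply: subset_hull; exists i.
split; first exact: Ph.
by rewrite inE; apply/asboolP/eqP => [[]|].
Qed.

(** A convex combination at which [h] vanishes gives no weight to generators where [h] is
    positive. *)
Lemma hull_tight_submx (I : finType) (y : I -> 'rV[R]_D) h p (m : nat)
    (M : 'M[R]_(m, 1 + D)) :
  (forall i, 0 <= affval h (y i)) ->
  (forall i, affval h (y i) = 0 -> (lift1 (y i) <= M)%MS) ->
  convex_hull (range y) p -> affval h p = 0 -> (lift1 p <= M)%MS.
Proof.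
move=> h0 hM /hull_combo[w [w0 w1 ->]]; rewrite affval_combo // => /eqP.
rewrite psumr_eq0 => [/allP wh|i _]; last by rewrite mulr_ge0.
have := sum_lift1 w y; rewrite w1 -/(lift1 _) => <-.
apply: summx_sub => i _; have := wh i; rewrite mem_index_enum mulf_eq0.
move=> /(_ isT)/orP[/eqP ->|/eqP /hM]; first by rewrite scale0r sub0mx.
exact: scalemx_sub.
Qed.

Lemma polytope_rank (n e : nat) (x : 'I_n -> 'rV[R]_D) P :
  P = convex_hull (range x) -> has_dim P e <-> \rank (liftmx x) = e.+1.
Proof.
move=> PE; apply: has_dim_rank => [p|i]; last first.
  by exists (x i); [rewrite PE; apply: subset_hull; exists i|rewrite rowK].
rewrite PE => Pp; apply: (hull_tight_submx (h := 0) _ _ Pp); rewrite ?affval0 //.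
  by move=> i; rewrite affval0.
by move=> i _; rewrite -[lift1 _](rowK (fun i => lift1 (x i))) row_sub.
Qed.

(** The lifts of the face cut out by [h] are spanned by those of the two points, which are
    independent because the points differ. *)
Lemma adjacent_exposed (n : nat) (x : 'I_n.+1 -> 'rV[R]_D) P (a b : 'I_n.+1) :
  ordered_polytope P x -> a != b -> exposed x [set a; b]%SET ->
  adjacent P (x a) (x b).
Proof.
move=> [xI PE vE] ab [h hS].
have Px i : P (x i) by rewrite PE; apply: subset_hull; exists i.
have ha i : i \in [set a; b]%SET -> affval h (x i) = 0.
  by move=> iS; apply/eqP; rewrite -(hS i).2.
split.
- by have : range x (x a) by []; rewrite -vE.
- by have : range x (x b) by []; rewrite -vE.
- by move=> /xI /eqP; rewrite (negPf ab).
exists [set p | P p /\ affval h p = 0]; split; last 2 first.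
- by split=> //; apply: ha; rewrite !inE eqxx.
- by split=> //; apply: ha; rewrite !inE eqxx orbT.
split.
  apply: halfspace_face => p; rewrite PE; apply: hull_affval_ge0 => i.
  exact: (hS i).1.
pose y (i : 'I_2) := if i == 0 then x a else x b.
apply/(@has_dim_rank _ _ _ (liftmx y)) => [p /= []|i|].
- rewrite PE; apply: hull_tight_submx => i; first exact: (hS i).1.
  move/eqP; rewrite -(hS i).2 !inE => /orP[]/eqP->.
    by rewrite -[x a]/(y 0) -[lift1 _](rowK (fun i => lift1 (y i))) row_sub.
  by rewrite -[x b]/(y 1) -[lift1 _](rowK (fun i => lift1 (y i))) row_sub.
- exists (y i); last by rewrite rowK.
  by rewrite /y; case: ifP => _ /=; split=> //; apply: ha; rewrite !inE eqxx ?orbT.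
suff /eqP : row_free (liftmx y) by [].
apply/affinely_independentP => t.
rewrite !big_ord_recl !big_ord0 !addr0 /y /= => t0 ty.
have t1 : t (lift ord0 ord0) = - t ord0 by apply/eqP; rewrite -addr_eq0 addrC t0.
have tz : t ord0 = 0.
  move/eqP: ty; rewrite t1 scaleNr -scalerBr scaler_eq0 subr_eq0 => /orP[/eqP //|].
  by move=> /eqP /xI /eqP; rewrite (negPf ab).
move=> i; case: (unliftP ord0 i) => [j|] -> //; by rewrite ord1 t1 tz oppr0.
Qed.

(** A face of a face is a face; this carries faces of a multiplex facet, its edges in particular,
    over to [P]. *)
Lemma exposed_in_face (m n : nat) (x : 'I_n -> 'rV[R]_D) (f : 'I_m -> 'I_n)
    P F (J : {set 'I_m}) :
  P = convex_hull (range x) -> face P F -> injective f ->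
  (forall i, F (x i) <-> exists l, i = f l) ->
  exposed (x \o f) J -> exposed x (f @: J)%SET.
Proof.
move=> PE faceF fI Ff [h2 hJ].
have [h1 h1P] := face_exposed PE faceF.
(* Tilting by a large multiple of h1 makes h2, which is only known to be
   nonnegative on F, positive off F as well. *)
pose K := 1 + \sum_i `|affval h2 (x i)| / affval h1 (x i).
exists (h2 + K *: h1) => i; rewrite affvalD affvalZ.
have [h1i] := h1P i; rewrite inE => Fi.
have [[l il]|nf] := pselect (exists l, i = f l).
  have /asboolP : F (x i) by apply/Ff; exists l.
  rewrite Fi => /eqP ->; rewrite mulr0 addr0.
  by have [h2l lJ] := hJ l; rewrite il (mem_imset _ _ fI) lJ.
have {}Fi : affval h1 (x i) != 0 by rewrite -Fi; apply/asboolP => /Ff.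
have h1p : 0 < affval h1 (x i) by rewrite lt_neqAle eq_sym Fi.
have Kge : 1 + `|affval h2 (x i)| / affval h1 (x i) <= K.
  rewrite lerD2l (bigD1 i) //= lerDl sumr_ge0 // => j _.
  by rewrite divr_ge0 // (h1P j).1.
have pos : 0 < affval h2 (x i) + K * affval h1 (x i).
  apply: (@lt_le_trans _ _ (affval h2 (x i) +
    (1 + `|affval h2 (x i)| / affval h1 (x i)) * affval h1 (x i))).
    rewrite mulrDl mul1r divfK // addrCA ltr_wpDr //.
    by rewrite -[X in X + _]opprK addrC subr_ge0 -normrN ler_norm.
  by rewrite lerD2l ler_pM2r.
split; first exact: ltW.
rewrite gt_eqF //; apply/negP => /imsetP[l _ il]; apply: nf; by exists l.
Qed.
End Geometry.

(** * Facets of polytopes and multiplexes *)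

Section Facets.
Context {R : realType} {D : nat}.
Implicit Types (P F : set 'rV[R]_D) (p q : 'rV[R]_D) (h : 'cV[R]_(1 + D)).

Lemma affval_mx (m : nat) (y : 'I_m -> 'rV[R]_D) (k : nat) (B : 'M_(1 + D, k)) i j :
  (liftmx y *m B) i j = affval (col j B) (y i).
Proof.
rewrite /affval -[lift1 _](rowK (fun i => lift1 (y i))) -/(liftmx y).
by rewrite -row_mul colE mulmxA -colE !mxE.
Qed.

(* Every face is the intersection of the facets containing it. *)
Lemma facet_sep (n d : nat) (x : 'I_n -> 'rV[R]_D) P (S : {set 'I_n}) t :
  P = convex_hull (range x) -> has_dim P d.+1 -> exposed x S -> t \notin S ->
  exists F, [/\ facet P F, forall i, i \in S -> F (x i) & ~ F (x t)].
Proof.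
move=> PE dimP expS tS.
(* A maximal exposed set that contains [S] and misses [t] will span the facet. *)
pose Q (T : {set 'I_n}) := `[< exposed x T >] && (t \notin T).
have QS : Q S by apply/andP; split=> //; apply/asboolP.
have [T /maxsetP[/andP[/asboolP [h hT] tT] Tmax] ST] := maxset_exists QS.
have h0 i : 0 <= affval h (x i) by have [] := hT i.
have TE i : (i \in T) = (affval h (x i) == 0) by have [] := hT i.
have Px i : P (x i) by rewrite PE; apply: subset_hull; exists i.
have rX : \rank (liftmx x) = d.+2 by apply/(polytope_rank d.+1 PE).
pose y (i : 'I_#|T|) := x (enum_val i).
have hy i : affval h (y i) = 0.
  by apply/eqP; rewrite -TE; apply: enum_valP.
have ySub i : i \in T -> (lift1 (x i) <= liftmx y)%MS.
  move=> iT; rewrite -(enum_rankK_in iT iT).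
  by rewrite -[lift1 _](rowK (fun i => lift1 (y i))) row_sub.
have xSub i : (lift1 (x i) <= liftmx x)%MS.
  by rewrite -[lift1 _](rowK (fun i => lift1 (x i))) row_sub.
(* The functional [h] vanishes on the span of [T] but not at [x t], so that span is proper. *)
have rle : (\rank (liftmx y) <= d.+1)%N.
  rewrite -ltnS -rX; suff : (liftmx y < liftmx x)%MS by rewrite ltmxErank => /andP[].
  rewrite /ltmx; apply/andP; split.
    by apply/row_subP => i; rewrite rowK xSub.
  apply/negP => /(submx_trans (xSub t)) /submxP[B tB].
  move: tT; rewrite TE /affval tB -mulmxA.
  suff -> : liftmx y *m h = 0 by rewrite mulmx0 mxE eqxx.
  apply/matrixP => i j; rewrite affval_mx mxE [j]ord1.
  by rewrite -[RHS](hy i); congr affval; apply/matrixP => a b; rewrite mxE [b]ord1.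
(* Were the rank too small, some g would vanish on T and at x t but not on P;
   rotating the hyperplane h in the direction g until it meets a new vertex
   contradicts the maximality of T. *)
have rge : (d.+1 <= \rank (liftmx y))%N.
  rewrite leqNgt; apply/negP => rlt.
  pose N := (liftmx y + lift1 (x t))%MS.
  have rN : (\rank N < \rank (liftmx x))%N.
    rewrite rX ltnS; apply: leq_trans (mxrank_adds_leqif _ _) _.
    by rewrite (leq_trans (leq_add (leqnn _) (rank_leq_row _))) // addn1.
  have gx : exists g, [/\ forall i, i \in T -> affval g (x i) = 0,
      affval g (x t) = 0 & exists i, affval g (x i) < 0].
    (* A column of the cokernel of [N] serves as [g], up to sign. *)
    have : liftmx x *m cokermx N != 0.
      by rewrite -submxE; apply: contraL rN => /mxrankS; rewrite -leqNgt.
    have NK p : (lift1 p <= N)%MS -> lift1 p *m cokermx N = 0.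
      by rewrite submxE => /eqP.
    case/matrix0Pn => i [j]; rewrite affval_mx; set g := col j _ => gi.
    have gN p : (lift1 p <= N)%MS -> affval g p = 0.
      by move/NK => E; rewrite /affval /g colE mulmxA E mul0mx mxE.
    have gT k : k \in T -> affval g (x k) = 0.
      by move/ySub => s; apply: gN; apply: submx_trans s (addsmxSl _ _).
    have gt : affval g (x t) = 0 by apply: gN; apply: addsmxSr.
    have [gi0|gi0|gi0] := ltgtP (affval g (x i)) 0.
    - by exists g; split=> //; exists i.
    - exists (- g); split; last by exists i; rewrite affvalN oppr_lt0.
        by move=> k /gT kT; rewrite affvalN kT oppr0.
      by rewrite affvalN gt oppr0.
    - by rewrite gi0 eqxx in gi.
  have [g [gT gt [i0 gi0]]] := gx.
  (* Ratio test: [r i1] is the least multiple of [g] that brings a point down to the hyperplane, so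
     [h'] stays nonnegative. *)
  pose r i := affval h (x i) / - affval g (x i).
  case: (@arg_minP _ _ _ i0 (fun i => affval g (x i) < 0) r gi0) => i1 gi1 rmin.
  have r0 : 0 <= r i1 by rewrite divr_ge0 // oppr_ge0 ltW.
  pose h' := h + r i1 *: g.
  have h'E i : affval h' (x i) = affval h (x i) + r i1 * affval g (x i).
    by rewrite affvalD affvalZ.
  have h'0 i : 0 <= affval h' (x i).
    rewrite h'E; have [gi|gi] := leP 0 (affval g (x i)).
      by rewrite addr_ge0 // mulr_ge0.
    have := rmin i gi; rewrite /r ler_pdivlMr ?oppr_gt0 // mulrN.
    by rewrite -subr_ge0 opprK.
  have i1T : i1 \notin T by apply: contraTN gi1 => /gT ->; rewrite ltxx.
  pose T' := [set i | affval h' (x i) == 0]%SET.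
  have QT' : Q T'.
    rewrite /Q inE h'E gt mulr0 addr0 -TE tT andbT; apply/asboolP.
    by exists h' => i; rewrite inE.
  have TT' : T \subset T'.
    apply/fintype.subsetP => i iT; rewrite inE h'E (gT i iT) mulr0 addr0 -TE //.
  case/negP: i1T; rewrite -(Tmax T' QT' TT') inE h'E /r.
  by rewrite invrN mulrN mulNr divfK ?subrr // lt_eqF.
have ryd : \rank (liftmx y) = d.+1 by apply/eqP; rewrite eqn_leq rle.
exists [set p | P p /\ affval h p = 0]; split.
- exists d; split=> //.
    apply: halfspace_face => p; rewrite PE; exact: hull_affval_ge0.
  apply/(@has_dim_rank _ _ _ _ _ (liftmx y)) => // [p /= []|i].
    rewrite PE; apply: hull_tight_submx => // i /eqP; rewrite -TE; exact: ySub.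
  exists (y i); last by rewrite rowK.
  by split; [apply: Px|apply: hy].
- by move=> i iS; split=> //; apply/eqP; rewrite -TE (fintype.subsetP ST).
- by move=> [_ /eqP]; rewrite -TE (negPf tT).
Qed.

(** * Facets and edges of a multiplex *)

Section Multiplex.
Variables (e N : nat) (z : 'I_N.+1 -> 'rV[R]_D) (F : set 'rV[R]_D).
Hypotheses (e_gt1 : (1 < e)%N) (Fz : multiplex e F z).

Lemma multiplex_size : (e <= N)%N.
Proof.
have [dimF [_ FE _] _] := Fz.
by have /(polytope_rank e FE) r := dimF; rewrite -ltnS -r rank_leq_row.
Qed.

(* The end facets, for i = 0 and i = N, do contain the vertex z_i: the clamped
   indices j < 0 and j > N produce it. *)
Definition facet_positions (i : 'I_N.+1) : {set 'I_N.+1} :=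
  [set a : 'I_N.+1 | [&& (a < i + e)%N, (i < a + e)%N &
    [|| a != i, i == 0 :> nat | i == N :> nat]]]%SET.

(** Vertices at these positions are generators of the facet. No other vertex lies in it: the
    functional supporting [F] at that vertex is positive at all the generators, hence on their
    hull. *)
Lemma multiplex_exposed i : exposed z (facet_positions i).
Proof.
have eN := multiplex_size.
have [dimF [zI FE vE] facets] := Fz.
have Gf : facet F (multiplex_facet e z i) by apply/facets; exists i.
have [? [_ Gface _]] := Gf.
have := face_exposed FE Gface; congr exposed; apply/setP => a; rewrite !inE.
have aN := ltn_ord a; have iN := ltn_ord i.
apply/asboolP/idP => [Ga|]; last first.
  move=> /and3P[ai ia nai]; apply: subset_hull.
  have [jP|jP] := boolP (a != i).
    exists a%:Z; last by congr z; apply/val_inj; rewrite /= inordK; lia.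
    have {}jP : a != i :> nat by rewrite (inj_eq val_inj).
    rewrite /=; lia.
  have {jP}ai' : a = i by apply/eqP; move: jP; rewrite negbK.
  subst a; move: nai; rewrite eqxx /= => /orP[/eqP i0|/eqP i0].
    (* The index -1 clamps to 0 and is admissible since [e] is at least 2; [N.+1] plays the same
       role at the other end. *)
    exists (-1)%Z; first by rewrite /= i0; lia.
    by congr z; apply/val_inj; rewrite /= i0.
  exists (N.+1)%:Z; first by rewrite /= i0; lia.
  by congr z; apply/val_inj; rewrite /= inordK; lia.
have va : vertex F (z a) by have : range z (z a) by []; rewrite -vE.
have [h [Fh hE]] := face_halfspace va.
have ha : affval h (z a) = 0 by have : [set z a] (z a) by []; rewrite hE => -[].
apply: contraT => nE; suff : 0 < affval h (z a) by rewrite ha ltxx.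
apply: hull_affval_gt0 Ga => _ [j /= jP <-].
have Fz' b : F (z b) by rewrite FE; apply: subset_hull; exists b.
have ca : clamp N j <> a.
  move=> ja; case/negP: nE; move: jP; rewrite -ja.
  case: j {ja} => j /= jP; rewrite -!(inj_eq val_inj) /=; last lia.
  by rewrite inordK; lia.
rewrite lt_neqAle Fh // andbT eq_sym; apply/eqP => zj.
have : [set z a] (z (clamp N j)) by rewrite hE.
by move=> /zI.
Qed.

Lemma multiplex_facet_avoiding (t : 'I_N.+1) (hd : (3 < e)%N) :
  exists E : {set 'I_N.+1}, [/\ exposed z E, t \notin E &
    forall a : 'I_N.+1, a != t -> (a <= t + 3)%N -> (t <= a + 3)%N -> a \in E].
Proof.
have eN := multiplex_size.
(* An inner [t] is omitted by the facet of its own number. End facets contain their own vertex, so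
   [t = 0] uses facet [e], whose positions start at 1, and [t = N] uses facet [N - e]. Three
   positions around [t] are covered because [e] is at least 4. *)
pose i : nat := if t == 0 :> nat then e else if t == N :> nat then (N - e)%N else t.
have iN : (i < N.+1)%N by have := ltn_ord t; rewrite /i; do ?[case: ifP => ?]; lia.
exists (facet_positions (Ordinal iN)); split; first exact: multiplex_exposed.
  rewrite inE -(inj_eq val_inj) /= /i; have := ltn_ord t; do ?[case: ifP => ?]; lia.
move=> a; rewrite !inE -!(inj_eq val_inj) /= /i.
have := ltn_ord a; have := ltn_ord t; do ?[case: ifP => ?]; lia.
Qed.

Lemma multiplex_edge (a b : 'I_N.+1) (hd : (3 < e)%N) :
  (a < b)%N -> (b <= a + 2)%N -> exposed z [set a; b]%SET.
Proof.
move=> ab ba; have eN := multiplex_size; apply: exposed_sep => c cS.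
have /andP[ca cb] : (c != a :> nat) && (c != b :> nat).
  by move: cS; rewrite !inE negb_or -!(inj_eq val_inj).
have aN := ltn_ord a; have bN := ltn_ord b; have cN := ltn_ord c.
suff [i [iN iP]] : exists i, exists iN : (i < N.+1)%N,
   [/\ a \in facet_positions (Ordinal iN), b \in facet_positions (Ordinal iN) &
       c \notin facet_positions (Ordinal iN)].
  exists (facet_positions (Ordinal iN)); have [ai bi ci] := iP; split=> //.
    exact: multiplex_exposed.
  by apply/fintype.subsetP => k; rewrite in_set2 => /orP[]/eqP->.
(* If [c] is far above [a], the facet [a.-1] stops before [c] and, as [e] is at least 4, still
   reaches [b]; symmetrically for [c] far below [b]. When truncated at an end, that facet contains
   its own vertex. Any nearer [c] is omitted as in [multiplex_facet_avoiding]. *)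
pose i : nat := if (a + e <= c)%N then a.-1 else if (c + e <= b)%N then minn b.+1 N
  else if c == 0 :> nat then e else if c == N :> nat then (N - e)%N else c.
have iN : (i < N.+1)%N by rewrite /i; do 4?[case: ifP => ?]; lia.
exists i, iN; rewrite !inE -!(inj_eq val_inj) /= /i.
by do 4?[case: ifP => ?]; split; lia.
Qed.
End Multiplex.
End Facets.

(** * Combinatorics of index sets: evenness, exchange and a Hamiltonian path *)

Section NatFamilies.
Local Open Scope nat_scope.

Section GaleFamily.
Variables (n : nat) (Fc : pred nat -> Prop).
Hypothesis bounded : forall y l, Fc y -> y l -> l <= n.
(** Gale evenness rules out runs of length one, and below of length three, that touch neither 0 nor
    [n]. *)
Hypothesis gale1 : forall y l, Fc y -> y l -> 0 < l < n -> y l.-1 || y l.+1.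
Hypothesis gale3 : forall y l, Fc y -> y l -> y l.+1 -> y l.+2 ->
  0 < l -> l.+2 < n -> y l.-1 || y l.+3.
(* Only the at most two elements of y strictly between q and t have to be
   listed by s: an element this close to t survives the exchange. *)
Hypothesis exchange : forall y t, Fc y -> y t -> exists y', [/\ Fc y', ~~ y' t &
  forall q s, y q -> q != t -> size s <= 2 ->
    (forall r, y r -> (q < r < t) || (t < r < q) -> r \in s) -> y' q].
Hypothesis cover : forall i, i <= n -> exists2 y, Fc y & y i.
Hypothesis large : forall y (s : seq nat), Fc y -> size s <= 4 ->
  exists2 q, y q & q \notin s.

(** If [i.+1] is absent, evenness puts [i.-1] in; exchanging [i.-1] away keeps its neighbour [i],
    and evenness then forces [i.+1]. *)
Lemma gale_pair i : 0 < i < n -> exists y, [/\ Fc y, y i & y i.+1].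
Proof.
move=> /andP[i0 i_n]; have [y Fy yi] := cover (ltnW i_n).
have [yi1|yi1] := boolP (y i.+1); first by exists y.
have := gale1 Fy yi; rewrite i0 i_n (negPf yi1) orbF => /(_ isT) yp.
have [y' [Fy' y'p keep]] := exchange Fy yp.
have y'i : y' i by apply: (keep i [::]) => //; [lia|move=> r _; lia].
have := gale1 Fy' y'i; rewrite i0 i_n (negPf y'p) => /(_ isT) /= ?.
by exists y'.
Qed.

Section NoTriple.
Variable i : nat.
Hypothesis no_triple : ~ exists y, [/\ Fc y, y i, y i.+1 & y i.+2].

(* Omitting j+1 while keeping i, i+1 and j forces j-1 in. *)
Lemma gale_no_right y j : Fc y -> y i -> y i.+1 -> y j -> i.+1 < j < n -> False.
Proof.
have [m] := ubnP j; elim: m y j => // m IH y j jm Fy yi yi1 yj /andP[ij jn].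
have yi2 y' : Fc y' -> y' i -> y' i.+1 -> ~~ y' i.+2.
  by move=> Fy' y'i y'i1; apply/negP => y'i2; apply: no_triple; exists y'.
(* An element strictly between [i.+1] and [j] falls under the induction hypothesis, so [j] may be
   taken nearest. *)
have [[r /andP[yr /andP[ir rj]]]|nor] :
    (exists r, y r && (i.+1 < r < j)) \/ forall r, y r -> i.+1 < r < j -> False.
  have [|h] := EM (exists r, y r && (i.+1 < r < j)); first by left.
  by right=> r yr rij; apply: h; exists r; rewrite yr.
- by apply: (IH y r); rewrite ?ir //; lia.
(* Hence [j.-1] still exceeds [i.+1], and the descent stays in range. *)
have ji2 : j != i.+2 by apply: contraTneq yj => ->; apply: yi2.
have yj1 : y j.+1.
  have := gale1 Fy yj; rewrite jn andbT => /(_ ltac:(lia)) /orP[yp|//].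
  by case: (nor _ yp); lia.
have [y' [Fy' y'j1 keep]] := exchange Fy yj1.
have y'j : y' j by apply: (keep j [::]) => //; [lia|move=> r _; lia].
have y'i1 : y' i.+1.
  apply: (keep _ [:: j]) => //; first lia.
  move=> r yr rij; rewrite inE; apply: contraT => rj; case: (nor r yr); lia.
(* Only [i.+1] and [j] lie between [i] and [j.+1] in [y], within the two elements that [exchange]
   allows. *)
have y'i : y' i.
  apply: (keep _ [:: i.+1; j]) => //; first lia.
  move=> r yr rij; rewrite !inE; apply: contraT => rj; case: (nor r yr); lia.
have := gale1 Fy' y'j; rewrite jn andbT (negPf y'j1) orbF => /(_ ltac:(lia)) y'p.
by apply: (IH y' j.-1) => //; lia.
Qed.

(* Omitting j-1 while keeping j, i and i+1 forces j+1 in; when j = i-1, the run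
   i-1, i, i+1 of odd length forces i+2 in. *)
Lemma gale_no_left y j :
  i.+1 < n -> Fc y -> y i -> y i.+1 -> y j -> 0 < j < i -> False.
Proof.
move=> i_n; have [m] := ubnP (i - j); elim: m y j => // m IH y j jm.
move=> Fy yi yi1 yj /andP[j0 ji].
have yi2 y' : Fc y' -> y' i -> y' i.+1 -> ~~ y' i.+2.
  by move=> Fy' y'i y'i1; apply/negP => y'i2; apply: no_triple; exists y'.
have [[r /andP[yr /andP[jr ri]]]|nor] :
    (exists r, y r && (j < r < i)) \/ forall r, y r -> j < r < i -> False.
  have [|h] := EM (exists r, y r && (j < r < i)); first by left.
  by right=> r yr rij; apply: h; exists r; rewrite yr.
  by apply: (IH y r); rewrite ?ri //; lia.
have yp : y j.-1.
  have [ij|ij] := eqVneq j.+1 i.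
    have := gale3 Fy yj; rewrite ij => /(_ yi yi1 j0 i_n) /orP[//|].
    by rewrite (negPf (yi2 y Fy yi yi1)).
  have := gale1 Fy yj; rewrite j0 => /(_ ltac:(lia)) /orP[//|yj1].
  by case: (nor _ yj1); lia.
have [y' [Fy' y'p keep]] := exchange Fy yp.
have y'j : y' j by apply: (keep j [::]) => //; [lia|move=> r _; lia].
have y'i : y' i.
  apply: (keep _ [:: j]) => //; first lia.
  move=> r yr rij; rewrite inE; apply: contraT => rj; case: (nor r yr); lia.
have y'i1 : y' i.+1.
  apply: (keep _ [:: j; i]) => //; first lia.
  move=> r yr rij; rewrite !inE; apply: contraT => rj; case: (nor r yr); lia.
have [ij|ij] := eqVneq j.+1 i.
  have := gale3 Fy' y'j; rewrite ij => /(_ y'i y'i1 j0 i_n).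
  by rewrite (negPf y'p) (negPf (yi2 y' Fy' y'i y'i1)).
have := gale1 Fy' y'j; rewrite j0 (negPf y'p) => /(_ ltac:(lia)) /= y'j1.
by apply: (IH y' j.+1) => //; lia.
Qed.
End NoTriple.

(** A set containing [i] and [i.+1] is large enough to have an element other than these, 0 and [n];
    without a triple, neither side can hold it. *)
Lemma gale_triple i :
  0 < i -> i.+1 < n -> exists y, [/\ Fc y, y i, y i.+1 & y i.+2].
Proof.
move=> i0 i_n; apply: contrapT => no_triple.
have [|y [Fy yi yi1]] := gale_pair (i := i); first lia.
have [//|q yq] := @large y [:: 0; i; i.+1; n] Fy.
rewrite !inE !negb_or => /and4P[q0 qi qi1 qn].
have qn' : q < n by have := bounded Fy yq; lia.
have [qlt|qge] := ltnP q i.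
  by apply: (gale_no_left no_triple i_n Fy yi yi1 yq); lia.
by apply: (gale_no_right no_triple Fy yi yi1 yq); lia.
Qed.
End GaleFamily.

(** By induction: the path from [n.-1] to [n], once reversed, ends at [n.-1], where [n.+1] can be
    appended. *)
Lemma square_path_hamiltonian (e : rel nat) n :
  symmetric e -> 0 < n -> e 0 1 -> (forall i, i + 2 <= n -> e i (i + 2)) ->
  exists s, [/\ perm_eq (n.-1 :: rcons s n) (iota 0 n.+1) &
                path e n.-1 (rcons s n)].
Proof.
move=> esym; case: n => // n _ e01; elim: n => [|n IH] e2.
  by exists [::]; rewrite /= e01.
have [|s [sp pth]] := IH; first by move=> i ?; apply: e2; lia.
exists (rcons (rev s) n).
have E : n.+1 :: rcons (rev s) n = rev (n :: rcons s n.+1).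
  by rewrite rev_cons rev_rcons.
split.
  rewrite -rcons_cons E -cats1 -(addn1 n.+2) iotaD perm_cat2r.
  by rewrite perm_rev.
rewrite /= rcons_path last_rcons -(addn2 n) e2 ?andbT; last lia.
have := rev_path e n (rcons s n.+1).
rewrite last_rcons belast_rcons rev_cons => ->.
by rewrite (eq_path (e' := e)) // => a b; rewrite esym.
Qed.
End NatFamilies.

(** When the whole gap lies in [Y], the count in [gale_subset] is the length of the gap. *)
Lemma gale_run (n : nat) (Y : {set 'I_n.+1}) (a b : nat) :
  gale_subset Y -> (a < b <= n)%N -> inord a \notin Y -> inord b \notin Y ->
  (forall k, (a < k < b)%N -> inord k \in Y) -> ~~ odd (b - a.+1).
Proof.
move=> galeY /andP[ab bn] aY bY runY.
have := galeY _ _ aY bY; rewrite !inordK ?ltnS //; last lia.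
move=> /(_ ab); congr (~~ odd _).
pose r : seq 'I_n.+1 := [seq inord k | k <- iota a.+1 (b - a.+1)].
have runiq : uniq r.
  rewrite map_inj_in_uniq ?iota_uniq // => i j; rewrite !mem_iota => ib jb.
  by move/(congr1 val); rewrite /= !inordK; lia.
rewrite -[RHS](size_iota a.+1) -(size_map (@inord n)) -/r -(card_uniqP runiq).
apply: eq_card => l; rewrite !inE; apply/idP/mapP => [/andP[lY lab]|[k]].
  by exists (nat_of_ord l); rewrite ?inord_val // mem_iota; lia.
rewrite mem_iota => kb ->; rewrite runY ?inordK; lia.
Qed.

(** * Facets and edges of an ordinary polytope *)

Section OrdinaryPolytope.
Context {R : realType} {D : nat}.
Variables (n d : nat) (P : set 'rV[R]_D) (x : 'I_n.+1 -> 'rV[R]_D).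
Hypotheses (d_gt4 : (4 < d)%N) (n_gt0 : (0 < n)%N) (hP : ordinary_polytope d P x).

Let PE : P = convex_hull (range x). Proof. by have [_ [[]]] := hP. Qed.
Let oP : ordered_polytope P x. Proof. by have [_ []] := hP. Qed.
Let dimP : has_dim P d.-1.+1.
Proof. by have [dP _ _] := hP; rewrite prednK //; lia. Qed.

Lemma facet_face F : facet P F -> face P F.
Proof. by move=> [e []]. Qed.

Lemma facet_vertex F i : facet P F -> F (x i) -> vertex F (x i).
Proof.
move=> [e [_ [c [b [Pb FE]]] _]] Fxi.
have [_ _ vE] := oP.
have : vertex P (x i) by have : range x (x i) by []; rewrite -vE.
move=> [c' [b' [Pb' xE]]]; exists c', b'; split.
  by move=> p; rewrite FE => -[Pp _]; apply: Pb'.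
apply/seteqP; split=> p /=.
  by move=> px; split; [rewrite px|have : [set x i] p by []; rewrite xE => -[]].
move=> [Fp pb]; suff : [set x i] p by [].
by rewrite xE; split=> //; move: Fp; rewrite FE => -[].
Qed.

Lemma facet_multiplex F : facet P F ->
  exists (N : nat) (f : 'I_N.+1 -> 'I_n.+1),
    [/\ {homo f : a b / (a < b)%N}, injective f, multiplex d.-1 F (x \o f) &
        forall i, F (x i) <-> exists l, i = f l].
Proof.
move=> Ff; have [_ _ fP] := hP; have [N [f [fhomo mF]]] := fP F Ff.
have [xI _ _] := oP.
have [_ [zI FE vE] _] := mF.
exists N, f; split=> //; first by move=> a b fab; apply: zI; rewrite /= fab.
move=> i; split=> [Fi|[l ->]].
  have : [set p | vertex F p] (x i) by apply: facet_vertex.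
  by rewrite vE => -[l _ /xI fl]; exists l.
by rewrite FE; apply: subset_hull; exists l.
Qed.

Lemma facet_gale F : facet P F -> gale_subset [set i | `[< F (x i) >]]%SET.
Proof.
move=> Ff; have [_ [_ gP] _] := hP; apply: (gP F Ff) => i; rewrite inE.
split=> [/asboolP|vi]; first exact: facet_vertex.
apply/asboolP; have [c [b [_ vE]]] := vi.
by have : [set x i] (x i) by []; rewrite vE => -[].
Qed.

(** A facet of the multiplex [F] that omits [x t] is a face of [P], so some facet of [P] contains it
    and omits [x t]. Vertices within three positions of [t] in [F] survive. *)
Lemma facet_exchange F t : facet P F -> F (x t) ->
  exists F', [/\ facet P F', ~ F' (x t) & forall q (s : seq nat),
    F (x q) -> q != t -> (size s <= 2)%N ->
    (forall r, F (x r) -> (q < r < t)%N || (t < r < q)%N -> val r \in s) ->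
    F' (x q)].
Proof.
move=> Ff Ft; have [N [f [fhomo fI mF FxE]]] := facet_multiplex Ff.
have [tau tE] : exists l, t = f l by apply/FxE.
have e1 : (1 < d.-1)%N by lia.
have e3 : (3 < d.-1)%N by lia.
have [E [expE tauE nearE]] := multiplex_facet_avoiding e1 mF tau e3.
have expx := exposed_in_face PE (facet_face Ff) fI FxE expE.
have tfE : t \notin (f @: E)%SET by rewrite tE (mem_imset _ _ fI).
have [F' [Ff' EF' F't]] := facet_sep PE dimP expx tfE.
exists F'; split=> // q s Fq qt s2 btw.
have [al qE] : exists l, q = f l by apply/FxE.
(* Positions more than three apart have at least three vertices between them, too many for [s]. *)
have far (a b : 'I_N.+1) : (a + 3 < b)%N ->
    (forall r : 'I_N.+1, (a < r < b)%N -> val (f r) \in s) -> False.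
  move=> ab ins; have bN := ltn_ord b.
  pose rs := [seq val (f (inord k)) | k <- iota a.+1 3].
  have : (size rs <= size s)%N; last by rewrite size_map size_iota; lia.
  apply: uniq_leq_size.
    rewrite map_inj_in_uniq ?iota_uniq // => i j; rewrite !mem_iota => ib jb.
    by move/val_inj/fI/(congr1 val); rewrite /= !inordK; lia.
  move=> w /mapP[k]; rewrite mem_iota => kb ->; apply: ins.
  by rewrite inordK; lia.
apply: EF'; rewrite qE; apply: imset_f; apply: nearE.
- by apply: contraNneq qt => alt; rewrite qE tE alt.
- rewrite leqNgt; apply/negP => /far; apply=> r /andP[r1 r2].
  apply: btw; first by apply/FxE; exists r.
  by apply/orP; right; rewrite qE tE !fhomo.
- rewrite leqNgt; apply/negP => /far; apply=> r /andP[r1 r2].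
  apply: btw; first by apply/FxE; exists r.
  by apply/orP; left; rewrite qE tE !fhomo.
Qed.

(** Separate the face consisting of [x i] from any other vertex. *)
Lemma vertex_facet i : exists2 F, facet P F & F (x i).
Proof.
have [xI _ vE] := oP.
have vi : face P [set x i] by have : range x (x i) by []; rewrite -vE.
pose t : 'I_n.+1 := if i == ord0 then ord_max else ord0.
have ti : t != i.
  rewrite /t; case: ifP => [/eqP ->|/negbT]; last by rewrite eq_sym.
  by rewrite -(inj_eq val_inj) /= -lt0n.
have tS : t \notin [set j | `[< [set x i]%classic (x j) >]]%SET.
  by rewrite inE; apply/asboolP => /xI /eqP; rewrite (negPf ti).
have [F [Ff SF _]] := facet_sep PE dimP (face_exposed PE vi) tS.
by exists F => //; apply: SF; rewrite inE; apply/asboolP.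
Qed.

(** A multiplex of dimension [d.-1] has at least [d] vertices, and [d] exceeds 4. *)
Lemma facet_large F (s : seq nat) : facet P F -> (size s <= 4)%N ->
  exists2 i, F (x i) & val i \notin s.
Proof.
move=> Ff s4; have [N [f [fhomo fI mF FxE]]] := facet_multiplex Ff.
have eN := multiplex_size mF.
have [|/hasPn ins] := boolP (has (fun l => val (f l) \notin s) (enum 'I_N.+1)).
  by move=> /hasP[l _ ls]; exists (f l) => //; apply/FxE; exists l.
have : (size [seq val (f l) | l <- enum 'I_N.+1] <= size s)%N.
  apply: uniq_leq_size; last by move=> w /mapP[l /ins] /negPn ls ->.
  by rewrite map_inj_uniq ?enum_uniq // => a b /val_inj/fI.
rewrite size_map size_enum_ord; lia.
Qed.

Lemma common_facet i : (0 < i)%N -> (i.+1 < n)%N ->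
  exists F, [/\ facet P F, F (x (inord i)), F (x (inord i.+1)) &
                F (x (inord i.+2))].
Proof.
(* The guard [k <= n] matters: [inord] sends larger numbers to 0. *)
pose Fc (y : pred nat) := exists2 F, facet P F &
  forall k, y k = (k <= n)%N && `[< F (x (inord k)) >].
have bounded y l : Fc y -> y l -> (l <= n)%N by move=> [F _ ->] /andP[].
have Fcgale y a b : Fc y -> (a < b <= n)%N -> ~~ y a -> ~~ y b ->
    (forall k, (a < k < b)%N -> y k) -> ~~ odd (b - a.+1).
  move=> [F Ff yE] /andP[ab bn]; rewrite !yE bn (leq_trans (ltnW ab) bn) /=.
  move=> ya yb yk.
  apply: (gale_run (facet_gale Ff)); rewrite ?inE ?ab // => k kab.
  by have := yk k kab; rewrite yE inE => /andP[].
move=> i0 i_n.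
have [|||||y [[F Ff yE] yi yi1 yi2]] := @gale_triple n Fc bounded _ _ _ _ _ i i0 i_n.
- move=> y l Fy yl l0; apply: contraT; rewrite negb_or => /andP[ya yb].
  have := Fcgale y l.-1 l.+1 Fy; have -> : (l.+1 - l.-1.+1 = 1)%N by lia.
  apply=> // [|k kl]; first lia.
  by have -> : k = l by lia.
- move=> y l Fy yl yl1 yl2 l0 l_n; apply: contraT; rewrite negb_or => /andP[ya yb].
  have := Fcgale y l.-1 l.+3 Fy; have -> : (l.+3 - l.-1.+1 = 3)%N by lia.
  apply=> // [|k kl]; first lia.
  have [->//|kl'] := eqVneq k l; have [->//|kl1] := eqVneq k l.+1.
  by have -> : k = l.+2 by lia.
- move=> y t [F Ff yE]; rewrite yE => /andP[tn /asboolP Ft].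
  have [F' [Ff' F't keep]] := facet_exchange Ff Ft.
  exists (fun k => (k <= n)%N && `[< F' (x (inord k)) >]); split.
  + by exists F'.
  + by rewrite tn /=; apply/asboolP.
  + move=> q s; rewrite yE => /andP[qn /asboolP Fq] qt s2 btw; rewrite qn /=.
    apply/asboolP/(keep _ s) => //.
      by rewrite -(inj_eq val_inj) /= !inordK.
    move=> r Fr; rewrite !inordK // => rqt; apply: btw => //.
    by rewrite yE -ltnS ltn_ord inord_val; apply/asboolP.
- move=> j jn; have [F Ff Fj] := vertex_facet (inord j).
  exists (fun k => (k <= n)%N && `[< F (x (inord k)) >]); first by exists F.
  by rewrite jn; apply/asboolP.
- move=> y s [F Ff yE] s4; have [j Fj js] := facet_large Ff s4.
  by exists (val j) => //; rewrite yE -ltnS ltn_ord inord_val; apply/asboolP.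
exists F; move: yi yi1 yi2; rewrite !yE.
by move=> /andP[_ /asboolP ?] /andP[_ /asboolP ?] /andP[_ /asboolP ?].
Qed.

Lemma adjacent_add2 i : (0 < i)%N -> (i.+1 < n)%N ->
  adjacent P (x (inord i)) (x (inord (i + 2))).
Proof.
move=> i0 i_n; have [F [Ff Fi _ Fi2]] := common_facet i0 i_n.
have [N [f [fhomo fI mF FxE]]] := facet_multiplex Ff.
have [al alE] : exists l, inord i = f l by apply/FxE.
have [be beE] : exists l, inord i.+2 = f l by apply/FxE.
have fal : f al = i :> nat by rewrite -alE inordK //; lia.
have fbe : f be = i.+2 :> nat by rewrite -beE inordK //; lia.
have e1 : (1 < d.-1)%N by lia.
have e3 : (3 < d.-1)%N by lia.
have alN := ltn_ord al; have beN := ltn_ord be.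
have ab : (al < be)%N.
  rewrite ltnNge leq_eqVlt; apply/negP => /orP[/eqP/val_inj E|/fhomo].
    by move: fal fbe; rewrite E; lia.
  by rewrite fal fbe; lia.
(* As [f] is strictly increasing, at most one position fits between those of [i] and [i.+2]. *)
have ba : (be <= al + 2)%N.
  rewrite leqNgt; apply/negP => far.
  have n1 : (al.+1 < N.+1)%N by lia.
  have n2 : (al.+2 < N.+1)%N by lia.
  have : (f al < f (Ordinal n1))%N by apply: fhomo.
  have : (f (Ordinal n1) < f (Ordinal n2))%N by apply: fhomo.
  have : (f (Ordinal n2) < f be)%N by apply: fhomo => /=; lia.
  by rewrite fal fbe; lia.
have := exposed_in_face PE (facet_face Ff) fI FxE (multiplex_edge e1 mF e3 ab ba).
rewrite imsetU1 imset_set1 -alE -beE addn2; apply: adjacent_exposed oP _.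
by rewrite -(inj_eq val_inj) /= !inordK; lia.
Qed.
End OrdinaryPolytope.

(** * Assembling the Hamiltonian cycle *)

Lemma adjacent_sym (R : realType) (D : nat) (P : set 'rV[R]_D) p q :
  adjacent P p q -> adjacent P q p.
Proof.
move=> [vp vq pq [F [eF Fp Fq]]]; split=> //; first by move/esym.
by exists F.
Qed.

Theorem proposition3p11 (R : realType) (D n k d m : nat)
    (P : set 'rV[R]_D) (x : 'I_n.+1 -> 'rV[R]_D)
    (hd : d = (2 * m + 1)%N) (hd5 : (5 <= d)%N) (hdk : (d <= k)%N)
    (hkn : (k <= n)%N)
    (hP : ordinary_polytope d P x) (hk : has_characteristic P x k) :
  exists s : seq 'rV[R]_D,
    hamiltonian_cycle [set p | vertex P p] (adjacent P) s.
Proof.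
pose e : rel nat := [rel a b | `[< adjacent P (x (inord a)) (x (inord b)) >]].
have n5 : (5 <= n)%N by lia.
have esym : symmetric e by move=> a b; apply/asboolP/asboolP; apply: adjacent_sym.
have e0 j : (0 < j <= k)%N -> e 0%N j.
  move=> jk; apply/asboolP; have -> : inord 0 = ord0 :> 'I_n.+1.
    by apply/val_inj; rewrite /= inordK.
  by apply/(hk.1 _); rewrite inordK; lia.
have en j : (n - k <= j < n)%N -> e j n.
  move=> jk; rewrite esym; apply/asboolP; have -> : inord n = ord_max :> 'I_n.+1.
    by apply/val_inj; rewrite /= inordK.
  by apply/(hk.2 _); rewrite inordK; lia.
have e2 i : (i + 2 <= n)%N -> e i (i + 2)%N.
  (* The pair 0, 2 comes from the characteristic, which is at least 5. *)
  move=> i_n; have [->|i0] := posnP i; first by apply: e0; lia.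
  by apply/asboolP/(adjacent_add2 (d := d)) => //; lia.
have [||s [sperm spath]] := square_path_hamiltonian esym _ _ e2; first lia.
  by apply: e0; lia.
have [xI _ vE] := let: And3 _ (conj o _) _ := hP in o.
have mem_s i : (i \in n.-1 :: rcons s n) = (i <= n)%N.
  by rewrite (perm_mem sperm) mem_iota.
exists [seq x (inord i) | i <- n.-1 :: rcons s n]; split.
- by rewrite size_map (perm_size sperm) size_iota; lia.
- rewrite map_inj_in_uniq ?(perm_uniq sperm) ?iota_uniq // => i j.
  rewrite !mem_s => i_n jn /xI/(congr1 val).
  by rewrite /= !inordK.
- move=> v; rewrite vE; split=> [/mapP[i _ ->]|[i _ <-]]; first by exists (inord i).
  by apply/mapP; exists (nat_of_ord i); rewrite ?inord_val // mem_s -ltnS ltn_ord.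
- rewrite /= -map_rcons path_map rcons_path last_rcons.
  apply/andP; split; first exact: spath.
  (* The closing edge joins [x_n] to [x_(n-1)], again by the characteristic. *)
  by have : e n n.-1 by rewrite esym; apply: en; lia.
Qed.
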